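(* Let $d=d(n)\ge 0$ be integers and $p=p(n)\in[0,1]$, and for each $n$ let $G\sim G_{n,p,d}$ be drawn from any $d$-dependent random graph distribution on $n$ vertices with edge probability $p$. (i) Suppose $f(n)$ is any function for which $f(n)\to\infty$ as $n\to\infty$. If $p>(d+1)\dfrac{\ln(n)+f(n)}{n}$, then $G$ is almost surely connected. (ii) If $np\to 0$, then almost surely $G$ is not connected.
   Context: A dependency graph for a finite family of random variables $(X_i)_{i\in I}$ is a (simple, undirected) graph on vertex set $I$ such that each $X_i$ is independent of the family of all $X_j$ ($j\ne i$) with $j$ not adjacent to $i$ (the notion used in the Lovász local lemma and Janson's inequality). The variables are $d$-locally dependent if they have a dependency graph of maximum degree at most $d$. A $d$-dependent random graph $G_{n,p,d}$ is any probability distribution on simple graphs on $n$ (labelled) vertices such that each of the $\binom n2$ potential edges is present with probability exactly $p$, and the indicator variables of the edges are $d$-locally dependent. The notation $G\sim G_{n,p,d}$ means $G$ is drawn from such a distribution. The parameters $p$ and $d$ may depend on $n$. An event happens almost surely if its probability tends to $1$ as $n\to\infty$. $\ln$ is the natural logarithm. *)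

(* Defs.v *)
From HB Require Import structures.
From mathcomp Require Import all_boot all_order all_algebra.
From mathcomp Require Import all_classical all_reals all_analysis.
From mathcomp Require Import measurable_realfun.
Set Implicit Arguments.
Unset Strict Implicit.
Unset Printing Implicit Defensive.
Import Order.TTheory GRing.Theory Num.Theory.
Import numFieldNormedType.Exports.
Local Open Scope classical_set_scope.
Local Open Scope ring_scope.

Definition edge (V : finType) : Type := {e : {set V} | #|e| == 2}.
HB.instance Definition _ (V : finType) := Finite.on (edge V).

(* Since V is the vertex set, a simple graph is determined by its edge set. *)
Definition sgraph (V : finType) : Type := {set edge V}.
HB.instance Definition _ (V : finType) := Finite.on (sgraph V).

Section simple_graphs.
Context {V : finType}.
Implicit Types (G : sgraph V) (u v : V).

(* Irreflexive, because [set u; u] is not an edge. *)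
Definition graph_adj G u v : bool := [exists e in G, val e == [set u; v]%SET].

Definition degree G v : nat := #|[set u | graph_adj G v u]%SET|.

Definition max_degree G : nat := (\max_(v : V) degree G v)%N.

(* The graph without vertices counts as connected. *)
Definition graph_connected G : bool :=
  [forall u, forall v, connect (graph_adj G) u v].

End simple_graphs.

(* Graphs carry the discrete sigma-algebra: as sgraph V is finite, a
   [probability (sgraph V) R] is an arbitrary distribution on simple graphs. *)
HB.instance Definition _ (V : finType) := isPointed.Build (sgraph V) finset.set0.
HB.instance Definition _ (V : finType) :=
  @isMeasurable.Build default_measure_display (sgraph V)
    discrete_measurable discrete_measurable0
    discrete_measurableC discrete_measurableU.

Section local_dependence.
Context {d d' : measure_display} {T : measurableType d} {R : realType}.
Context {E : measurableType d'} {I : finType}.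
Variables (P : probability T R) (X : I -> {RV P >-> E}).

Definition sigma_family (J : {set I}) : set (set T) :=
  <<s \bigcup_(j in [set` J]) g_sigma_algebra_preimage (X j) >>.

Definition independent_of_family (i : I) (J : {set I}) : Prop :=
  forall A B : set T,
    g_sigma_algebra_preimage (X i) A -> sigma_family J B ->
    (P (A `&` B) = P A * P B)%E.

Definition dependency_graph (D : sgraph I) : Prop :=
  forall i : I,
    independent_of_family i [set j | (j != i) && ~~ graph_adj D i j]%SET.

Definition locally_dependent (k : nat) : Prop :=
  exists D : sgraph I, dependency_graph D /\ (max_degree D <= k)%N.

End local_dependence.

Section random_graphs.
Context {R : realType} {V : finType}.
Implicit Type P : probability (sgraph V) R.

Definition edge_present (e : edge V) : set (sgraph V) := [set G | e \in G].

Lemma measurable_edge_present (e : edge V) : measurable (edge_present e).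
Proof. by []. Qed.

Definition edge_indicator P (e : edge V) : {RV P >-> R} :=
  indic_mfun (edge_present e) (measurable_edge_present e).

Definition dependent_random_graph (k : nat) (p : R) P : Prop :=
  (forall e : edge V, P (edge_present e) = p%:E) /\
  locally_dependent (edge_indicator P) k.

End random_graphs.

(* "Almost surely" in the asymptotic sense of random graph theory. *)
Definition asymptotically_almost_surely (R : realType) (V : nat -> finType)
    (P : forall n, probability (sgraph (V n)) R)
    (A : forall n, set (sgraph (V n))) : Prop :=
  P n (A n) @[n --> \oo] --> 1%E.

(* Main.v *)
(**
Let D be a dependency graph of maximum degree at most k for the edge
indicators, and J a set of potential edges.  Pick e in J and drop from J the
edge e and its at most k neighbours in D: e is independent of what remains, so
by induction
P(no edge of J is present) <= (1 - p) exp(-p (|J| - k - 1) / (k + 1))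
<= exp(-p |J| / (k + 1)).  A disconnected graph has no edge across some cut
with sides of sizes j <= n / 2 and n - j, and the union bound over the cuts is
dominated by the geometric series of ratio exp(2 - f(n) / 2).  Conversely, in a
connected graph on at least two vertices a given vertex has an incident edge,
which has probability at most n p.
*)
Require Import Defs.
From mathcomp Require Import all_boot all_order all_algebra.
From mathcomp Require Import all_classical all_reals all_analysis.
From mathcomp Require Import lra.
Import Order.TTheory GRing.Theory Num.Theory.
Import numFieldNormedType.Exports.
Local Open Scope classical_set_scope.
Local Open Scope ring_scope.

(** * Estimate of one term of the union bound *)

(** Accounts for all cuts with [k] vertices on the smaller side at once. With
    ['C(n, k) <= (e n / k) ^ k], the exponent per vertex becomes
    [1 - ln k + (k / n) ln n - c (1 - k / n)], whose logarithms contribute at most [1] by [key]. *)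
Lemma bin_cut_le_expR (R : realType) (n k : nat) (c : R) :
  (0 < k)%N -> (k.*2 <= n)%N -> 0 <= c ->
  'C(n, k)%:R * expR (- ((k * (n - k))%:R * ((ln n%:R + c) / n%:R)))
    <= expR (2 - c / 2) ^+ k.
Proof.
move=> k0 kn c0.
have kn' : (k <= n)%N by apply: leq_trans kn; rewrite -addnn leq_addl.
have n0 : (0 < n)%N by apply: leq_trans kn'.
have x0 : 0 < k%:R :> R by rewrite ltr0n.
have y0 : 0 < n%:R :> R by rewrite ltr0n.
have lnk0 : 0 <= ln k%:R :> R by rewrite ln_ge0// ler1n.
have ynz : n%:R != 0 :> R by rewrite gt_eqF.
have xnz : k%:R != 0 :> R by rewrite gt_eqF.
have knR : 2 * k%:R <= n%:R :> R by rewrite -natrM ler_nat mul2n.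
(* [(k / e) ^ k <= k!], as [k ^ k / k!] is a term of the series of [exp k] *)
have fact_ge : expR (k%:R * (ln k%:R - 1)) <= (k`!)%:R :> R.
  rewrite mulrBr mulr1 expRB expRM_natl lnK ?posrE// ler_pdivrMr ?expR_gt0//.
  rewrite mulrC -ler_pdivrMr ?ltr0n ?fact_gt0//.
  apply: le_trans (_ : 1 + k%:R ^+ k / k`!%:R <= _).
    by rewrite lerDr.
  by rewrite -{2 3}(prednK k0) expR_ge1Dxn// ltW.
have bin_le : 'C(n, k)%:R <= expR (k%:R * (1 + ln n%:R - ln k%:R)) :> R.
  have -> : k%:R * (1 + ln n%:R - ln k%:R) =
            k%:R * ln n%:R - k%:R * (ln k%:R - 1) :> R by lra.
  rewrite expRB expRM_natl lnK ?posrE// ler_pdivlMr ?expR_gt0//.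
  apply: le_trans (ler_wpM2l _ fact_ge) _ => //.
  rewrite -natrM -natrX ler_nat bin_ffact.
  (* What remains is [n ^_ k <= n ^ k]. *)
  move=> {k0 kn kn' x0 lnk0 xnz knR fact_ge n0 y0 ynz}; elim: k n => [|k IH] [|n];
    rewrite ?ffactn0//.
  rewrite ffactnS expnS leq_mul2l/=.
  apply: leq_trans (IH _) _ => /=.
  by case: k {IH} => // k; rewrite leq_exp2r.
(* From [ln (n / k) <= n / k - 1]; this makes [key] hold without studying the
   monotonicity of [ln x / x]. *)
have lnle : ln n%:R <= ln k%:R + n%:R / k%:R - 1 :> R.
  rewrite {1}(_ : n%:R = k%:R * (n%:R / k%:R) :> R); last first.
    by rewrite mulrCA divff ?mulr1.
  rewrite lnM ?posrE ?divr_gt0//.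
  have := @le_ln1Dx R (n%:R / k%:R - 1).
  rewrite [1 + _]addrC subrK.
  have : 0 < n%:R / k%:R :> R by rewrite divr_gt0.
  move=> h /(_ ltac:(lra)); lra.
have key : k%:R / n%:R * ln n%:R <= ln k%:R + 1 :> R.
  apply: le_trans (ler_wpM2l _ lnle) _; first by rewrite divr_ge0// ltW.
  have -> : k%:R / n%:R * (ln k%:R + n%:R / k%:R - 1) =
     k%:R / n%:R * ln k%:R + 1 - k%:R / n%:R :> R.
    rewrite mulrBr mulr1 mulrDr; congr (_ + _ - _).
    by rewrite mulrA mulfVK// divff.
  have : 0 <= k%:R / n%:R :> R by rewrite divr_ge0// ltW.
  have : k%:R / n%:R <= 1 :> R by rewrite ler_pdivrMr//; lra.
  by move=> h1 h0; have := ler_wpM2r lnk0 h1; lra.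
rewrite -expRM_natl.
apply: le_trans (ler_wpM2r (expR_ge0 _) bin_le) _.
rewrite -expRD ler_expR natrM natrB//.
have -> : k%:R * (1 + ln n%:R - ln k%:R) +
   - (k%:R * (n%:R - k%:R) * ((ln n%:R + c) / n%:R)) =
  k%:R * (1 - ln k%:R + k%:R / n%:R * ln n%:R - c * (1 - k%:R / n%:R)) :> R.
  have e : (n%:R - k%:R) / n%:R = 1 - k%:R / n%:R :> R by rewrite mulrBl divff.
  rewrite [_ * ((_ + c) / _)]mulrCA -2!mulrA [(_ - _) / _]e; lra.
rewrite ler_pM2l//.
(* As [k <= n / 2], at least half of [c] survives. *)
have : k%:R / n%:R <= 1 / 2 :> R by rewrite ler_pdivrMr//; lra.
nra.
Qed.

(** * Union bound, empty cuts and edges at a vertex *)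

Lemma measure_union_bound (d : measure_display) (T : measurableType d)
    (R : realType) (mu : {measure set T -> \bar R}) (I : finType)
    (P : pred I) (A : set T) (B : I -> set T) :
  measurable A -> (forall i, measurable (B i)) ->
  (forall x, A x -> exists2 i, P i & B i x) ->
  (mu A <= \sum_(i | P i) mu (B i))%E.
Proof.
move=> mA mB AB.
have -> : (\sum_(i | P i) mu (B i) = \sum_(i \in [set` P]) mu (B i))%E.
  by rewrite bigfs ?index_enum_uniq// => i _; rewrite mem_index_enum.
by apply: content_sub_fsum => // x /AB [i Pi Bi]; exists i.
Qed.

Definition no_edge {V : finType} (J : {set edge V}) : set (sgraph V) :=
  \bigcap_(e in [set` J]) ~` edge_present e.

Lemma no_edge_subset {V : finType} (J J' : {set edge V}) :
  J \subset J' -> no_edge J' `<=` no_edge J.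
Proof. by move=> /fintype.subsetP JJ' g gJ e /JJ'; exact: gJ. Qed.

(** Symmetric in the two sides, so that [S] may be exchanged for its complement. *)
Definition cut {V : finType} (S : {set V}) : {set edge V} :=
  [set e | (val e :&: S != finset.set0) && (val e :&: ~: S != finset.set0)]%SET.

(** The map from pairs [(a, b)], with [a] in [S] and [b] outside, to edges [{a, b}] is injective:
    the side tells the endpoints apart. *)
Lemma leq_card_cut {V : finType} (S : {set V}) :
  (#|S| * (#|V| - #|S|) <= #|cut S|)%N.
Proof.
rewrite -(cardsC S) addKn.
have <- : #|[set [set u.1; u.2]%SET | u in finset.setX S (~: S)]%SET| =
    (#|S| * #|~: S|)%N.
  rewrite card_in_imset ?cardsX// => -[a b] [a' b']; rewrite !inE /=.
  move=> /andP[aS bS] /andP[aS' bS'] /setP h.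
  have := h a; rewrite !inE eqxx/= => /esym/orP[] /eqP ea; last first.
    by rewrite -ea aS in bS'.
  have := h b; rewrite !inE eqxx orbT => /esym/orP[] /eqP eb.
    by rewrite eb aS' in bS.
  by rewrite ea eb.
rewrite -[leqRHS](card_imset _ val_inj); apply/subset_leq_card.
apply/fintype.subsetP => x /imsetP[[a b]].
rewrite !inE /= => /andP[aS bS] ->.
have ab : #|[set a; b]%SET| == 2.
  by move: bS; rewrite cards2; case: (a =P b) => // <-; rewrite aS.
apply/imsetP; exists (exist _ [set a; b]%SET ab : edge V) => //.
rewrite inE; apply/andP; split; apply/set0Pn.
  by exists a; rewrite !inE eqxx.
by exists b; rewrite !inE eqxx orbT.
Qed.

(** If [u] does not reach [v], no edge leaves the component of [u]. It contains [u] and its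
    complement contains [v]; the smaller of the two serves as [S]. *)
Lemma disconnected_cut {V : finType} (g : sgraph V) : ~~ graph_connected g ->
  exists2 S : {set V},
    (0 < #|S|)%N && (#|S|.*2 <= #|V|)%N & no_edge (cut S) g.
Proof.
case/forallPn => u /forallPn[v uv].
pose C := [set w | connect (graph_adj g) u w]%SET.
have dC : no_edge (cut C) g.
  move=> e /=; rewrite inE => + eg.
  case/andP => /set0Pn[a] + /set0Pn[b]; rewrite !inE.
  move=> /andP[ae uda] /andP[be ub].
  have ab : a != b by apply: contraNneq ub => <-.
  move/negP: ub; apply.
  apply: connect_trans uda (connect1 _); apply/existsP; exists e; rewrite eg/=.
  rewrite eq_sym eqEcard finset.subUset !finset.sub1set ae be.
  by rewrite (eqP (valP e)) cards2 ab.
have cutC : cut (~: C) = cut C by apply/setP => e; rewrite !inE finset.setCK andbC.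
have uC : u \in C by rewrite inE connect0.
have vC : v \in ~: C by rewrite !inE.
have := cardsC C.
case: (leqP #|C| #|~: C|) => h /esym cV; [exists C|exists (~: C)]; rewrite ?cutC//.
  by rewrite cV -addnn leq_add2l h andbT card_gt0; apply/set0Pn; exists u.
by rewrite cV -addnn leq_add2r (ltnW h) andbT card_gt0; apply/set0Pn; exists v.
Qed.


(** The first edge of a path from [v] to any other vertex will do. *)
Lemma connected_edge_at (V : finType) (g : sgraph V) (v : V) :
  (1 < #|V|)%N -> graph_connected g ->
  exists2 e : edge V, v \in val e & e \in g.
Proof.
move=> V1 /forallP/(_ v)/forallP cg.
have /set0Pn[w] : ([set~ v] != finset.set0)%SET.
  by rewrite -card_gt0 cardsC1 -ltnS prednK// ltnW.
rewrite !inE => wv; have /connectP[[|x p]/=] := cg w.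
  by move=> _ E; rewrite E eqxx in wv.
move=> /andP[/existsP[e /andP[eg /eqP vx]] _] _; exists e => //.
by rewrite vx !inE eqxx.
Qed.

(** Each edge at [v] is the image of its other endpoint [w] under [w |-> {v, w}]. *)
Lemma leq_card_edges_at (V : finType) (v : V) :
  (#|[set e : edge V | v \in val e]%SET| <= #|V|)%N.
Proof.
rewrite -[leqLHS](card_imset _ val_inj).
apply: leq_trans (leq_imset_card (fun w => [set v; w]%SET) V).
apply/subset_leq_card/fintype.subsetP => _ /imsetP[e + ->]; rewrite inE => ve.
have /cards2P[x [y [xy exy]]] := valP e; rewrite exy !inE in ve *.
by apply/imsetP; case/orP: ve => /eqP ->;
  [exists y|exists x; rewrite // finset.setUC].
Qed.

(** * Probability that a set of edges is absent *)

Section absent_edges.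
Context {R : realType} {V : finType} (P : probability (sgraph V) R).

Lemma absent_sigma_preimage (e : edge V) :
  g_sigma_algebra_preimage (edge_indicator P e) (~` edge_present e).
Proof.
exists [set 0 : R]; first exact: measurable_set1.
apply/seteqP; split => g /=.
  move=> [_]; rewrite -[LHS]/(\1_(edge_present e) g) indicE => + eg.
  by rewrite mem_set// => /eqP; rewrite oner_eq0.
move=> eg; split => //; rewrite -[LHS]/(\1_(edge_present e) g) indicE.
by rewrite memNset.
Qed.

Lemma no_edge_sigma (J : {set edge V}) :
  sigma_family (edge_indicator P) J (no_edge J).
Proof.
set F := \bigcup_(j in [set` J]) g_sigma_algebra_preimage (edge_indicator P j).
apply: (@fin_bigcap_measurable _ (g_sigma_algebraType F)) => // e eJ.
apply: sub_sigma_algebra; exists e => //; exact: absent_sigma_preimage.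
Qed.

Lemma prob_no_edge (k : nat) (p : R) (J : {set edge V}) : 0 <= p ->
  dependent_random_graph k p P ->
  (P (no_edge J) <= (expR (- (p * #|J|%:R / (k%:R + 1))))%:E)%E.
Proof.
move=> p0 [Pp [D [dD dk]]].
have k0 : 0 < k%:R + 1 :> R by rewrite ltr_wpDl.
(* Strong induction on [#|J|], as one step may remove several edges. *)
have [m] := ubnP #|J|; elim: m J => // m IH J; rewrite ltnS => Jm.
have [->|[e eJ]] := set_0Vmem J.
  by rewrite cards0 mulr0 mul0r oppr0 expR0 probability_le1.
pose N := (e |: [set j | graph_adj D e j])%SET.
pose J' := (J :\: N)%SET.
(* [k.+1] counts [e] and its at most [k] neighbours. *)
have NJ : (#|J| <= #|J'| + k.+1)%N.
  rewrite -(cardsID N J) addnC leq_add2l.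
  apply: leq_trans (subset_leq_card (subsetIr _ _)) _.
  rewrite cardsU1 -addn1 addnC leq_add ?leq_b1//.
  by apply: leq_trans dk; rewrite -/(degree D e) leq_bigmax.
have J'm : (#|J'| < m)%N.
  apply: leq_trans Jm; apply: proper_card; apply/properP; split.
    exact: subsetDl.
  by exists e => //; rewrite !inE eqxx.
have indep : P (~` edge_present e `&` no_edge J') =
    (P (~` edge_present e) * P (no_edge J'))%E.
  apply: (dD e); first exact: absent_sigma_preimage.
  (* [K] holds all non-neighbours of [e] except [e] itself. It contains [J'], hence its
     sigma-algebra contains that of [J']. *)
  set K := (X in sigma_family _ X).
  have JK : J' \subset K.
    apply/fintype.subsetP => j; rewrite !inE negb_or -andbA => /and3P[-> ->//].
  have := no_edge_sigma J'; apply: sub_sigma_algebra2; move=> A [j jJ' Aj].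
  by exists j => //; exact: (fintype.subsetP JK).
apply: (@le_trans _ _ (P (~` edge_present e `&` no_edge J'))).
  apply: le_measure; rewrite ?inE//.
  move=> g gJ; split; first by apply: gJ.
  by apply: no_edge_subset gJ; exact: subsetDl.
rewrite indep probability_setC// Pp -EFinB.
apply: le_trans (lee_wpmul2l _ (IH _ J'm)) _.
  (* [p <= 1] because [p] is the probability that [e] is present. *)
  rewrite lee_fin subr_ge0 -lee_fin -(Pp e).
  exact/probability_le1/measurable_edge_present.
rewrite -EFinM lee_fin.
(* The factor [1 - p <= expR (- p)] pays for the [k + 1] edges dropped, at [p / (k + 1)] each. *)
apply: le_trans (ler_wpM2r (expR_ge0 _) (expR_ge1Dx (- p))) _.
rewrite -expRD ler_expR.
have -> : - p = - (p * (k%:R + 1) / (k%:R + 1)) by rewrite mulfK// gt_eqF.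
rewrite -opprD lerN2 -!mulrA -mulrDr -mulrDl ler_wpM2l//.
rewrite ler_wpM2r ?invr_ge0 ?(ltW k0)//.
by rewrite natr1 -natrD ler_nat addnC.
Qed.

End absent_edges.

(** * Bounds for a fixed number of vertices *)

(** For [q <= 1 / 2] the map [s |-> 1 + q * s] preserves the bound [2]. *)
Lemma geometric_sum_le2 (R : realFieldType) (q : R) (n : nat) :
  0 <= q -> q <= 1 / 2 -> \sum_(k < n) q ^+ k <= 2.
Proof.
move=> q0 q1; elim: n => [|n IH]; first by rewrite big_ord0.
rewrite big_ord_recl expr0.
under eq_bigr do rewrite exprS.
rewrite -mulr_sumr.
have := ler_wpM2l q0 IH; lra.
Qed.

Lemma prob_disconnected (R : realType) (n k : nat) (p c : R)
    (P : probability (sgraph 'I_n) R) :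
  (0 < n)%N -> dependent_random_graph k p P ->
  0 <= c -> expR (2 - c / 2) <= 1 / 2 ->
  (k%:R + 1) * ((ln n%:R + c) / n%:R) <= p ->
  (P [set g : sgraph 'I_n | ~~ graph_connected g] <=
     (2 * expR (2 - c / 2))%:E)%E.
Proof.
move=> n0 Pdep c0 q1 cp; set q := expR _ in q1 *.
have q0 : 0 <= q by exact: expR_ge0.
have k0 : 0 < k%:R + 1 :> R by rewrite ltr_wpDl.
have a0 : 0 <= (ln n%:R + c) / n%:R :> R.
  by rewrite divr_ge0// addr_ge0// ln_ge0// ler1n.
have p0 : 0 <= p by apply: le_trans cp; rewrite mulr_ge0// ltW.
pose Q j := (0 < j)%N && (j.*2 <= n)%N.
(* [F j] bounds the probability that a given cut with sides [j] and [n - j] is empty; the degree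
   bound [k] cancels by [cp]. *)
pose F j := expR (- ((j * (n - j))%:R * ((ln n%:R + c) / n%:R))).
apply: (@le_trans _ _ (\sum_(S : {set 'I_n} | Q #|S|) (F #|S|)%:E)%E).
  apply: (@le_trans _ _ (\sum_(S : {set 'I_n} | Q #|S|) P (no_edge (cut S)))%E).
    apply: measure_union_bound => // g /disconnected_cut[S].
    by rewrite card_ord => QS dS; exists S.
  apply: lee_sum => S _; apply: le_trans (prob_no_edge _ _ _ _ p0 Pdep) _.
  rewrite lee_fin ler_expR lerN2 mulrAC.
  have := leq_card_cut S; rewrite card_ord -(ler_nat R) => Sc.
  apply: le_trans (ler_wpM2r a0 Sc) _; rewrite mulrC ler_wpM2r//.
  by rewrite ler_pdivlMr// mulrC.
rewrite sumEFin lee_fin.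
(* Group the vertex sets by size. *)
rewrite (partition_big (fun S : {set 'I_n} => inord #|S| : 'I_n.+1)
  (fun j : 'I_n.+1 => Q j)) /=; last first.
  by move=> S; rewrite inordK// ltnS -[leqRHS]card_ord max_card.
apply: (@le_trans _ _ (\sum_(j < n.+1 | Q j) q ^+ j)).
  apply: ler_sum => j Qj.
  rewrite (eq_bigl
    (fun S : {set 'I_n} => S \in [set S : {set 'I_n} | #|S| == j]%SET)).
    rewrite (eq_bigr (fun=> F j)); last by move=> S; rewrite inE => /eqP ->.
    rewrite sumr_const card_draws card_ord -mulr_natl.
    by case/andP: Qj => j0 jn; exact: bin_cut_le_expR.
  move=> S; rewrite inE -val_eqE /= inordK; last first.
    by rewrite ltnS -[leqRHS]card_ord max_card.
  by case: (#|S| =P j) => [->|_]; rewrite ?andbF// Qj.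
apply: (@le_trans _ _ (\sum_(j < n.+1 | (0 < j)%N) q ^+ j)).
  rewrite big_mkcond [leRHS]big_mkcond; apply: ler_sum => j _ /=.
  by rewrite /Q; case: ltnP => //= _; case: ifP => // _; rewrite exprn_ge0.
(* The sum starts at [j = 1], so one factor [q] comes out. *)
rewrite big_mkcond big_ord_recl /= add0r.
under eq_bigr do rewrite exprS.
rewrite -mulr_sumr mulrC ler_wpM2r//; exact: geometric_sum_le2.
Qed.

(** A single vertex is connected without any edge, hence [1 < n]. *)
Lemma prob_connected_le (R : realType) (n k : nat) (p : R)
    (P : probability (sgraph 'I_n) R) :
  (1 < n)%N -> 0 <= p -> dependent_random_graph k p P ->
  (P [set g : sgraph 'I_n | graph_connected g] <= (n%:R * p)%:E)%E.
Proof.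
move=> n1 p0 [Pp _]; pose v : 'I_n := Ordinal (ltnW n1).
apply: (@le_trans _ _ (\sum_(e : edge 'I_n | v \in val e) P (edge_present e))%E).
  apply: measure_union_bound => // g /(@connected_edge_at _ _ v).
  by rewrite card_ord => /(_ n1) [e ve eg]; exists e.
under eq_bigr do rewrite Pp.
rewrite sumEFin lee_fin sumr_const -[leLHS]mulr_natl ler_wpM2r// ler_nat.
by have := leq_card_edges_at _ v; rewrite card_ord cardsE.
Qed.

(** * Passage to the limit *)

(** The probability is squeezed between [1 - u n] and [1]. An eventual bound suffices, so small [n]
    and small [f n] may be discarded. *)
Lemma cvg_prob1 (R : realType) (V : nat -> finType)
    (P : forall n, probability (sgraph (V n)) R)
    (A : forall n, set (sgraph (V n))) (u : nat -> R) :
  (\forall n \near \oo, P n (~` A n) <= (u n)%:E)%E ->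
  u n @[n --> \oo] --> (0 : R) ->
  asymptotically_almost_surely P A.
Proof.
move=> Pu u0; apply: (@squeeze_cvge _ _ _ _ (fun n => (1 - u n)%:E) _ (cst 1%E)).
- near=> n; rewrite probability_le1// andbT -[A n]setCK probability_setC//.
  rewrite EFinB; apply: leeB => //; near: n; exact: Pu.
- apply: cvg_EFin; first by near=> n.
  rewrite -[X in _ --> X]subr0; apply: cvgB => //; exact: cvg_cst.
- exact: cvg_cst.
Unshelve. all: by end_near.
Qed.

Theorem theorem5 (R : realType) (d : nat -> nat) (p : nat -> R)
    (hp : forall n : nat, 0 <= p n <= 1)
    (G : forall n : nat, probability (sgraph 'I_n) R)
    (hG : forall n : nat, dependent_random_graph (d n) (p n) (G n)) :
  (forall f : nat -> R,
     f n @[n --> \oo] --> +oo ->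
     (forall n : nat, (0 < n)%N ->
        ((d n)%:R + 1) * ((ln n%:R + f n) / n%:R) < p n) ->
     asymptotically_almost_surely G
       (fun n => [set g : sgraph 'I_n | graph_connected g])) /\
  (n%:R * p n @[n --> \oo] --> (0 : R) ->
     asymptotically_almost_surely G
       (fun n => [set g : sgraph 'I_n | ~~ graph_connected g])).
Proof.
split=> [f foo fp|np0].
  have e0 : expR (- (f n / 2 - 2)) @[n --> \oo] --> (0 : R).
    apply: (@cvg_comp _ _ _ (fun n => f n / 2 - 2) (fun x => expR (- x))
      _ _ _ _ (@cvgr_expR R)).
    apply/cvgryPge => A; near=> n.
    (* Chosen so that [A <= f n / 2 - 2]. *)
    have : 2 * A + 4 <= f n by near: n; move/cvgryPge : foo; exact.
    lra.
  apply: (@cvg_prob1 _ _ _ _ (fun n => 2 * expR (- (f n / 2 - 2)))).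
    near=> n.
    rewrite opprB (_ : ~` _ = [set g | ~~ graph_connected g]).
      apply: prob_disconnected (hG n) _ _ _ => //.
      + by near: n; exact: nbhs_infty_gt.
      + by near: n; move/cvgryPge : foo; exact.
      (* The ratio tends to [0], so it is eventually at most [1 / 2]. *)
      + near: n.
        have h2 : 0 < 1 / 2 :> R by lra.
        move/cvgr0Pnorm_le : e0 => /(_ _ h2); apply: filterS => n.
        by rewrite ger0_norm ?expR_ge0// opprB.
      + apply/ltW/fp; near: n; exact: nbhs_infty_gt.
    by apply/seteqP; split => g /= /negP.
  rewrite -[X in _ --> X](mulr0 2); exact: cvgMr.
- apply: (@cvg_prob1 _ _ _ _ (fun n => n%:R * p n)) => //.
  near=> n; rewrite (_ : ~` _ = [set g | graph_connected g]).
    apply: prob_connected_le (hG n).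
    + by near: n; exact: nbhs_infty_gt.
    + by case/andP: (hp n).
  by apply/seteqP; split => g /= => [/negP/negPn|->].
Unshelve. all: by end_near.
Qed.
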